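(* Let $A\subset \mathbb{F}_q$ be an additive group (that is, an additive subgroup of $\mathbb{F}_q$) with $|A|\ge 2$. Suppose that \[ |A^{-1} \cap (cG +d)| \ll \max\{|G|^{1/2}, |A|^{4/7}\} \] for all subfields $G$ of $\mathbb{F}_q$ and all elements $c, d$ in $\mathbb{F}_q$. Then, for each choice of the sign $\pm$, \[ |1/A \pm 1/A| \gg (\log|A|)^{-1/3}\cdot \min\{|A|^{1+1/21},\ q^{1/19}|A|^{1-1/19}\}. \] Alternatively (without assuming that $|A^{-1} \cap (cG +d)| \ll \max\{|G|^{1/2}, |A|^{4/7}\}$ for all subfields $G$ of $\mathbb{F}_q$ and all $c,d\in\mathbb{F}_q$), the estimate $|1/A \pm 1/A| \gg (\log|A|)^{-1/3}\cdot \min\{|A|^{1+1/21},\ q^{1/19}|A|^{1-1/19}\}$ holds, for each choice of the sign $\pm$, if $|A| \not\in (|G|^{1/2}, |G|^{1+3/7})$ for all proper subfields $G$ of $\mathbb{F}_q$.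
   Context: $q$ is a power of a prime and $\mathbb{F}_q$ is the finite field with $q$ elements. For $X\subset\mathbb{F}_q$, $X^{-1}=1/X=\{1/x: x\in X,\ x\neq 0\}$. $X\pm Y=\{x\pm y:x\in X,y\in Y\}$ and $cG+d=\{cg+d: g\in G\}$. $X\gg Y$ (equivalently $Y\ll X$) means $Y\le CX$ for an absolute constant $C>0$; where $\ll$ occurs in a hypothesis it is assumed with some fixed absolute constant, uniformly in $G,c,d$, and the implied constant in the conclusion may depend on that constant only. *)

(* Defs.v *)
From HB Require Import structures.
From mathcomp Require Import all_boot all_order all_algebra.
From mathcomp Require Import reals exp.

Set Implicit Arguments.
Unset Strict Implicit.
Unset Printing Implicit Defensive.

Import Order.TTheory GRing.Theory Num.Theory.

Local Open Scope ring_scope.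

Section SetArithmetic.
Variable F : finFieldType.
Implicit Types (X Y G : {set F}) (c d : F).

Definition inv_set X : {set F} := [set x^-1 | x in X & x != 0].

Definition sumset X Y : {set F} := [set x + y | x in X, y in Y].

Definition diffset X Y : {set F} := [set x - y | x in X, y in Y].

Definition affine_image c G d : {set F} := [set c * g + d | g in G].

Definition additive_subgroup (A : {set F}) : Prop := zmod_closed A.

(* In a field, 0^-1 = 0, so closure under division carries no side condition
   and divring_closed says exactly that G is a subfield. *)
Definition subfield (G : {set F}) : Prop := divring_closed G.

Definition proper_subfield (G : {set F}) : Prop :=
  subfield G /\ G \proper [set: F].

End SetArithmetic.

Section Bounds.
Variables (R : realType) (F : finFieldType).
Implicit Types (A : {set F}).

Definition subfield_bound (K : R) A : Prop :=
  forall G : {set F}, subfield G -> forall c d : F,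
    #|inv_set A :&: affine_image c G d|%:R
      <= K * Num.max (#|G|%:R `^ (1 / 2)) (#|A|%:R `^ (4 / 7)).

Definition avoids_subfield_ranges A : Prop :=
  forall G : {set F}, proper_subfield G ->
    ~ (#|G|%:R `^ (1 / 2) < (#|A|%:R : R) < #|G|%:R `^ (1 + 3 / 7)).

Definition growth A : R :=
  ln #|A|%:R `^ (- (1 / 3))
  * Num.min (#|A|%:R `^ (1 + 1 / 21))
            (#|F|%:R `^ (1 / 19) * #|A|%:R `^ (1 - 1 / 19)).

Definition growth_estimate (C : R) A : Prop :=
  C * growth A <= #|sumset (inv_set A) (inv_set A)|%:R
  /\ C * growth A <= #|diffset (inv_set A) (inv_set A)|%:R.

End Bounds.

Arguments avoids_subfield_ranges R {F} A.

(* Main.v *)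
Require Import Defs.
From HB Require Import structures.
From mathcomp Require Import all_boot all_order all_algebra.
From mathcomp Require Import finfield.
From mathcomp Require Import reals exp.
From mathcomp Require Import ring lra zify.

(** Write [B] for [1/A], [n] for its size and [K * n] for the size of [B + B].
    As [A = - A], the sets [B + B] and [B - B] coincide, so both signs are
    treated at once. The claim amounts to [n << K^21], with
    [q << K^19 * n] as a second way out.

    Inversion turns translates of [B] into dilates: for nonzero [x] in [A] the
    reciprocals of [1/x + B] (0 being its own) fill [x + x^2 B], since
    [1/(1/x + 1/u) = x - x^2/(x + u)] and [x + u] runs through the group [A]
    ([reciprocal_shift_sub]). So about [n] sets [x + x^2 B], of size [n] each,
    live among the [K * n] reciprocals of [B + B], and for some [x0] the set
    attached to [x0] meets the others in [n/K] points on average. By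
    Pluennecke's inequality, a large intersection of the sets attached to [x0]
    and [y] makes [B + (y/x0)^2 B] small ([expansion_popular]). Let the expansion
    [e r] be the ratio of the sizes of [B + r B] and [B]. One obtains a large
    set [X] of squares [(y/x0)^2] with [e << K^3] on [X], and with the sum of
    [1/e] over [X] at least of order [n/K^3] ([popular_squares]).

    Small expansion survives ring operations, again by Pluennecke: the elements
    of the ratio set [Q = (X - X)/(X - X)] have expansion [<< K^12], and all
    [x * q] and [1 + q], with [x] in [X] and [q] in [Q], have expansion
    [<< K^15]. Suppose that one of the latter, say [xi], is not in [Q]. Then the
    sums [r = x + xi * y] are distinct for distinct pairs, and each satisfies
    [e r << e x * e y * e xi] on a large subset of [B], so that
    [b + r * c = b' + r * c'] has many solutions in [B]; as a nontrivial solution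
    determines [r], this is possible only if [n << K^21] ([expansion_pivot]).

    Otherwise [Q] is a subfield [G] ([ratio_set_subfield]), of size [<< K^12 * n],
    that contains [X]. The elements whose square is in [G] fill at most two
    cosets of its multiplicative group, so [A] meets a dilate of [G], and [1/A]
    the inverse dilate, in [>> n/K] elements ([expansion_or_subfield]). Under
    the first hypothesis this forces [n << K^14] or [n^3 << K^7]. Under the
    second one, either [G] is the whole field and [q << K^12 * n], or the size
    of [A] lies outside the forbidden range, which gives [n << K^12] or
    [n^3 << K^10].

    The logarithmic factor is at most [(ln 2)^(-1/3)], and is absorbed in the
    constants. *)

Set Implicit Arguments.
Unset Strict Implicit.
Unset Printing Implicit Defensive.

Import Order.TTheory GRing.Theory Num.Theory.

Local Open Scope ring_scope.

Lemma le_of_eq (R : porderType ring_display) (x y : R) : x = y -> x <= y.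
Proof. by move=> ->. Qed.

(** * Cauchy-Schwarz for families of sets *)

Section PairwiseIntersections.

Lemma cauchy_schwarz_card (T : finType) (U : {set T}) (m : T -> nat) :
  ((\sum_(e in U) m e) ^ 2 <= #|U| * \sum_(e in U) m e ^ 2)%N.
Proof.
rewrite -(leq_pmul2l (isT : 0 < 2)%N).
have -> : (2 * (#|U| * \sum_(e in U) m e ^ 2)
  = \sum_(e in U) \sum_(d in U) (m e ^ 2 + m d ^ 2))%N.
  under [RHS]eq_bigr => e _ do rewrite big_split /= sum_nat_const.
  by rewrite big_split /= -big_distrr /= sum_nat_const mul2n addnn.
rewrite -mulnn big_distrl /= big_distrr /=; apply: leq_sum => e _.
rewrite !big_distrr /=; apply: leq_sum => d _.
exact: nat_Cauchy.
Qed.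

(** Cauchy-Schwarz applied to the number [m e] of sets of the family that
    contain the point [e] of [U]: the first moment of [m] is the sum of the
    sizes, and its second moment is the sum of the pairwise intersections. It
    is used both to find popular intersections and to bound energies below. *)
Lemma card_pairwise_inter (I T : finType) (J : {set I}) (E : I -> {set T})
    (U : {set T}) :
  (forall i, i \in J -> E i \subset U) ->
  ((\sum_(i in J) #|E i|) ^ 2
     <= #|U| * \sum_(i in J) \sum_(j in J) #|E i :&: E j|)%N.
Proof.
move=> EU; pose m e := (\sum_(i in J) (e \in E i))%N.
have cardE i : i \in J -> #|E i| = (\sum_(e in U) (e \in E i))%N.
  move=> iJ; rewrite -sum1_card big_mkcond /= [RHS]big_mkcond /=.
  apply: eq_bigr => e _; case: (boolP (e \in E i)) => [eE|]; last by case: ifP.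
  by rewrite (subsetP (EU i iJ)).
have -> : (\sum_(i in J) #|E i| = \sum_(e in U) m e)%N.
  by rewrite exchange_big /=; apply: eq_bigr.
have -> : (\sum_(i in J) \sum_(j in J) #|E i :&: E j|
           = \sum_(e in U) m e ^ 2)%N.
  under [RHS]eq_bigr => e _ do rewrite -mulnn big_distrl /=.
  rewrite [RHS]exchange_big /=; apply: eq_bigr => i iJ.
  under [RHS]eq_bigr => e _ do rewrite big_distrr /=.
  rewrite [RHS]exchange_big /=; apply: eq_bigr => j jJ.
  rewrite -sum1_card big_mkcond /= [RHS]big_mkcond /=.
  apply: eq_bigr => e _; rewrite inE.
  case: (boolP (e \in E i)) => [eE|_] /=; last by case: ifP.
  by rewrite (subsetP (EU i iJ)) //; case: (e \in E j).
exact: cauchy_schwarz_card.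
Qed.

End PairwiseIntersections.

(** * Sumsets and dilates *)

Section Sumsets.
Variable F : finFieldType.
Implicit Types (A B C U V X Y Z : {set F}) (r t : F).

Definition dilate r X : {set F} := [set r * x | x in X].

Lemma sumsetP X Y z :
  reflect (exists x y, [/\ x \in X, y \in Y & z = x + y]) (z \in sumset X Y).
Proof.
by apply: (iffP imset2P) => [[x y xX yY ->]|[x [y [xX yY ->]]]];
  [exists x, y | exists x y].
Qed.

Lemma mem_sumset X Y x y : x \in X -> y \in Y -> x + y \in sumset X Y.
Proof. by move=> xX yY; apply/sumsetP; exists x, y. Qed.

Lemma sumsetC X Y : sumset X Y = sumset Y X.
Proof.
by apply/setP=> z; apply/sumsetP/sumsetP => -[x [y [xX yY ->]]];
  exists y, x; rewrite addrC.
Qed.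

Lemma sumsetA X Y Z : sumset X (sumset Y Z) = sumset (sumset X Y) Z.
Proof.
apply/setP=> z; apply/sumsetP/sumsetP.
  move=> [x [w [xX /sumsetP [y [v [yY vZ ->]]] ->]]].
  by exists (x + y), v; rewrite addrA mem_sumset.
move=> [w [v [/sumsetP [x [y [xX yY ->]]] vZ ->]]].
by exists x, (y + v); rewrite addrA mem_sumset.
Qed.

Lemma sumsetS X X' Y Y' :
  X \subset X' -> Y \subset Y' -> sumset X Y \subset sumset X' Y'.
Proof. exact: imset2S. Qed.

Lemma sumset0l Y : sumset set0 Y = set0.
Proof. by apply/setP=> z; rewrite inE; apply/sumsetP => -[x [y []]]; rewrite inE. Qed.

Lemma sumset1 X t : sumset X [set t] = [set x + t | x in X].
Proof.
apply/setP=> z; apply/sumsetP/imsetP.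
  by move=> [x [y [xX /set1P -> ->]]]; exists x.
by move=> [x xX ->]; exists x, t; rewrite inE eqxx.
Qed.

Lemma card_sumset1 X t : #|sumset X [set t]| = #|X|.
Proof. by rewrite sumset1 card_imset //; apply: addIr. Qed.

Lemma sumset_0 X : sumset X [set 0] = X.
Proof.
by rewrite sumset1 -[RHS]imset_id; apply: eq_imset => x; rewrite addr0.
Qed.

Lemma sumsetUl U V Y : sumset (U :|: V) Y = sumset U Y :|: sumset V Y.
Proof.
apply/setP=> z; rewrite inE; apply/sumsetP/orP.
  move=> [x [y [/setUP [xU|xV] yY ->]]]; [left|right]; exact: mem_sumset.
move=> [] /sumsetP [x [y [xX yY ->]]]; exists x, y; split=> //.
  by rewrite inE xX.
by rewrite inE xX orbT.
Qed.

Lemma card_sumset_ge X Y : Y != set0 -> (#|X| <= #|sumset X Y|)%N.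
Proof.
move=> /set0Pn [y yY]; rewrite -(card_sumset1 X y).
by apply/subset_leq_card/sumsetS; rewrite ?sub1set.
Qed.

(** The only property of [Z |-> #|Z + Y|] that Petridis' argument uses, besides
    invariance under translations. Since it is stable under nonnegative
    combinations, that argument works for several [Y] at the same time. *)
Lemma card_sumset_submod U V Y :
  (#|sumset (U :|: V) Y| + #|sumset (U :&: V) Y|
     <= #|sumset U Y| + #|sumset V Y|)%N.
Proof.
rewrite sumsetUl -[leqRHS]cardsUI leq_add2l; apply: subset_leq_card.
by rewrite subsetI !sumsetS ?subsetIl ?subsetIr.
Qed.

Lemma card_dilate r X : r != 0 -> #|dilate r X| = #|X|.
Proof. by move=> r0; rewrite card_imset //; apply: mulfI. Qed.

Lemma dilate_sumset r X Y : dilate r (sumset X Y) = sumset (dilate r X) (dilate r Y).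
Proof.
apply/setP=> z; apply/imsetP/sumsetP.
  move=> [w /sumsetP [x [y [xX yY ->]]] ->].
  by exists (r * x), (r * y); rewrite mulrDr !imset_f.
move=> [w [v [/imsetP [x xX ->] /imsetP [y yY ->] ->]]].
by exists (x + y); rewrite ?mulrDr ?mem_sumset.
Qed.

Lemma dilateM r t X : dilate (r * t) X = dilate r (dilate t X).
Proof. by rewrite /dilate -imset_comp; apply: eq_imset => x /=; rewrite mulrA. Qed.

Lemma dilate1 X : dilate 1 X = X.
Proof. by rewrite -[RHS]imset_id; apply: eq_imset => x; rewrite mul1r. Qed.

Lemma dilateD_sub r t X : dilate (r + t) X \subset sumset (dilate r X) (dilate t X).
Proof.
by apply/subsetP=> _ /imsetP [x xX ->]; rewrite mulrDl mem_sumset ?imset_f.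
Qed.

Lemma dilate_eq0 r X : X != set0 -> dilate r X != set0.
Proof. by move=> /set0Pn [x xX]; apply/set0Pn; exists (r * x); apply: imset_f. Qed.

End Sumsets.

(** * Pluennecke inequalities with several summands *)

Section Pluennecke.
Variables (R : realFieldType) (F : finFieldType).
Implicit Types (A B C U V X Y Z : {set F}).

(** Petridis' argument run on the functional
    [f Z = \sum_Y #|Z + Y| / #|A + Y|]. If [Z] minimises [f Z / #|Z|] among
    the nonempty subsets of [A], then [f (Z + C) <= (f Z / #|Z|) * #|Z + C|]
    for every [C], by induction on [C]: adding one point to [C] adds a
    translate of [Z] to [Z + C], and the overlap is a translate of a subset of
    [A], to which minimality applies. The weights [1 / #|A + Y|] make each
    summand of [f A] at most 1, so that the minimal ratio is at most
    [size Ys / #|A|], and a single [Z] serves all the [Y]; the price is the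
    factor [size Ys]. *)
Lemma petridis A (Ys : seq {set F}) : A != set0 ->
  exists Z, [/\ Z \subset A, Z != set0 &
    forall Y C, Y \in Ys ->
      #|sumset (sumset Z C) Y|%:R
        <= (size Ys)%:R * (#|sumset A Y|%:R / #|A|%:R) * #|sumset Z C|%:R :> R].
Proof.
move=> A0.
have cA0 : 0 < #|A|%:R :> R by rewrite ltr0n card_gt0.
pose f Z : R := \sum_(Y <- Ys) #|sumset Z Y|%:R / #|sumset A Y|%:R.
have f_submod U V : f (U :|: V) + f (U :&: V) <= f U + f V.
  rewrite -!big_split /=; apply: ler_sum => Y _.
  rewrite -!mulrDl ler_wpM2r ?invr_ge0 // -!natrD ler_nat.
  exact: card_sumset_submod.
have f_transl Z t : f (sumset Z [set t]) = f Z.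
  apply: eq_bigr => Y _.
  by rewrite -sumsetA (sumsetC [set t]) sumsetA card_sumset1.
have fA : f A <= (size Ys)%:R.
  rewrite -sum1_size natr_sum; apply: ler_sum => Y _.
  case: (eqVneq (#|sumset A Y|%:R : R) 0) => [->|ne]; first by rewrite mul0r.
  by rewrite divff.
pose ratio Z := f Z / #|Z|%:R.
have [Z /andP [ZA Z0] Zmin] :=
  @arg_minP _ _ _ A (fun Z => (Z \subset A) && (Z != set0)) ratio
    (introT andP (conj (subxx A) A0)).
have cZ0 : 0 < #|Z|%:R :> R by rewrite ltr0n card_gt0.
pose k := ratio Z.
have k0 : 0 <= k.
  by rewrite divr_ge0 // sumr_ge0 // => Y _; rewrite divr_ge0.
have kA : k <= (size Ys)%:R / #|A|%:R.
  apply: le_trans (Zmin A _) _; first by rewrite subxx A0.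
  by rewrite ler_wpM2r ?invr_ge0.
have kle (W : {set F}) : W \subset A -> k * #|W|%:R <= f W.
  move=> WA; case: (eqVneq W set0) => [->|W0].
    by rewrite cards0 mulr0 sumr_ge0 // => Y _; rewrite divr_ge0.
  have := Zmin W; rewrite WA W0 => /(_ isT).
  by rewrite -/k /ratio ler_pdivlMr // ltr0n card_gt0.
exists Z; split=> //.
have key (C : {set F}) : f (sumset Z C) <= k * #|sumset Z C|%:R.
  have [m] := ubnP #|C|; elim: m C => // m IH C; rewrite ltnS => Cm.
  case: (set_0Vmem C) => [->|[c cC]].
    rewrite sumsetC sumset0l cards0 mulr0 /f big1 // => Y _.
    by rewrite sumset0l cards0 mul0r.
  pose U := sumset Z (C :\ c); pose V := sumset Z [set c].
  have -> : sumset Z C = U :|: V.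
    by rewrite /U /V ![sumset Z _]sumsetC -sumsetUl setUC setD1K.
  have fU : f U <= k * #|U|%:R.
    by apply: IH; move: Cm; rewrite (cardsD1 c) cC.
  have fV : f V = k * #|V|%:R.
    by rewrite f_transl card_sumset1 /k /ratio divfK // gt_eqF.
  (* The overlap lies in [Z + c], hence its translate by [- c] lies in [A]. *)
  have fI : k * #|U :&: V|%:R <= f (U :&: V).
    rewrite -(f_transl _ (- c)) -(card_sumset1 (U :&: V) (- c)).
    apply: kle; apply: subset_trans ZA; rewrite sumset1.
    apply/subsetP=> _ /imsetP [w /setIP [_ wV] ->].
    by move: wV; rewrite /V sumset1 => /imsetP [z zZ ->]; rewrite addrK.
  have := f_submod U V; have : k * #|U :|: V|%:R + k * #|U :&: V|%:R =
    k * #|U|%:R + k * #|V|%:R by rewrite -!mulrDr -!natrD cardsUI.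
  lra.
move=> Y C YYs.
case: (posnP #|sumset A Y|) => [AY0|AYp].
  have -> : sumset (sumset Z C) Y = set0.
    apply/eqP; rewrite -subset0; move/eqP: AY0; rewrite cards_eq0 => /eqP AY0.
    move/eqP: A0 AY0 => A0 AY0; rewrite -sumsetA (sumsetC C) sumsetA.
    have -> : sumset Z Y = set0.
      by apply/eqP; rewrite -subset0 -AY0 sumsetS.
    by rewrite sumset0l.
  by rewrite cards0 !mulr_ge0 // invr_ge0.
have AYp' : 0 < #|sumset A Y|%:R :> R by rewrite ltr0n.
have : #|sumset (sumset Z C) Y|%:R / #|sumset A Y|%:R <= f (sumset Z C).
  rewrite /f (big_rem Y) //= lerDl sumr_ge0 // => W _; exact: divr_ge0.
move=> /le_trans /(_ (key C)).
rewrite ler_pdivrMr // => /le_trans; apply.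
rewrite mulrAC ler_wpM2r // [k * _]mulrC.
have -> : (size Ys)%:R * (#|sumset A Y|%:R / #|A|%:R)
  = #|sumset A Y|%:R * ((size Ys)%:R / #|A|%:R) :> R by ring.
by rewrite ler_wpM2l.
Qed.

Definition sumsets (Ys : seq {set F}) : {set F} := foldr (@sumset F) [set 0] Ys.

Lemma pluennecke_subset A (Ys : seq {set F}) : A != set0 ->
  exists Z, [/\ Z \subset A, Z != set0 &
    #|sumset Z (sumsets Ys)|%:R
      <= (\prod_(Y <- Ys) ((size Ys)%:R * (#|sumset A Y|%:R / #|A|%:R)))
         * #|Z|%:R :> R].
Proof.
move=> A0; have [Z [ZA Z0 HZ]] := petridis Ys A0; exists Z; split=> //.
move: HZ; set k := size Ys => HZ; move: (Ys) HZ => Ys'.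
elim: Ys' => [|Y Ys' IH] HZ /=; first by rewrite big_nil mul1r sumset_0.
rewrite big_cons (sumsetC Y) sumsetA.
apply: le_trans (HZ Y _ _) _; first by rewrite inE eqxx.
rewrite -[leRHS]mulrA ler_wpM2l ?mulr_ge0 ?invr_ge0 //.
by apply: IH => W C WYs; apply: HZ; rewrite inE WYs orbT.
Qed.

(** In terms of a pivot [A]: if every [A + Y] is small compared to [A], so is
    the sum of all the [Y]. With two summands this plays the role of Ruzsa's
    triangle inequality. *)
Lemma pluennecke A (Ys : seq {set F}) : A != set0 ->
  #|sumsets Ys|%:R
    <= (\prod_(Y <- Ys) ((size Ys)%:R * (#|sumset A Y|%:R / #|A|%:R)))
       * #|A|%:R :> R.
Proof.
move=> A0; have [Z [ZA Z0 HZ]] := pluennecke_subset Ys A0.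
apply: le_trans (_ : #|sumset Z (sumsets Ys)|%:R <= _).
  by rewrite ler_nat sumsetC card_sumset_ge.
apply: le_trans HZ _; rewrite ler_wpM2l ?ler_nat ?subset_leq_card //.
by apply: prodr_ge0 => Y _; rewrite !mulr_ge0 ?invr_ge0.
Qed.

(** The set given by [pluennecke_subset] may be tiny, which would make it
    useless for energy estimates. Taking a maximal subset [A'] for which the
    bound holds cures this: if it had less than half of the elements,
    [pluennecke_subset] applied to the rest of [A] would give a set that can be
    added to [A']. *)
Lemma pluennecke_half A Y1 Y2 : A != set0 ->
  exists A', [/\ A' \subset A, (#|A| <= 2 * #|A'|)%N &
    #|sumset A' (sumset Y1 Y2)|%:R
      <= 16 * (#|sumset A Y1|%:R / #|A|%:R) * (#|sumset A Y2|%:R / #|A|%:R)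
         * #|A'|%:R :> R].
Proof.
move=> A0; have cA0 : 0 < #|A|%:R :> R by rewrite ltr0n card_gt0.
set c := 16 * _ * _.
have c0 : 0 <= c by rewrite !mulr_ge0 ?invr_ge0.
pose ok A' := (A' \subset A) &&
  (#|sumset A' (sumset Y1 Y2)|%:R <= c * #|A'|%:R :> R).
have ok0 : ok set0 by rewrite /ok sub0set sumset0l cards0 mulr0 lexx.
have [A' /andP [A'A A'c] A'max] :=
  @arg_maxnP _ set0 ok (fun A' : {set F} => #|A'|) ok0.
exists A'; split=> //; rewrite leqNgt; apply/negP => small.
pose D := A :\: A'.
have cD : (#|A| <= 2 * #|D|)%N.
  by have := cardsID A' A; rewrite (setIidPr A'A) -/D; lia.
have cDA : #|A|%:R <= 2 * #|D|%:R :> R by rewrite -natrM ler_nat.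
have cD0 : 0 < #|D|%:R :> R by lra.
have D0 : D != set0 by rewrite -card_gt0 -(ltr0n R).
have [Z [ZD Z0 HZ]] := pluennecke_subset [:: Y1; Y2] D0.
have ratio Y : #|sumset D Y|%:R / #|D|%:R
    <= 2 * (#|sumset A Y|%:R / #|A|%:R) :> R.
  rewrite ler_pdivrMr //.
  apply: le_trans (_ : #|sumset A Y|%:R <= _).
    by rewrite ler_nat subset_leq_card // sumsetS // subsetDl.
  have -> : 2 * (#|sumset A Y|%:R / #|A|%:R) * #|D|%:R
    = #|sumset A Y|%:R * ((2 * #|D|%:R) / #|A|%:R) :> R by ring.
  by rewrite ler_peMr // ler_pdivlMr // mul1r.
have disj : #|A' :|: Z| = (#|A'| + #|Z|)%N.
  rewrite cardsU; have -> : A' :&: Z = set0.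
      apply/setP=> x; rewrite !inE; apply/negP => /andP [xA' /(subsetP ZD)].
      by rewrite inE xA'.
    by rewrite cards0 subn0.
have okU : ok (A' :|: Z).
  rewrite /ok subUset A'A (subset_trans ZD (subsetDl _ _)) /= sumsetUl.
  rewrite disj natrD mulrDr.
  apply: le_trans
    (_ : (#|sumset A' (sumset Y1 Y2)| + #|sumset Z (sumset Y1 Y2)|)%:R <= _).
    by rewrite ler_nat leq_card_setU.
  rewrite natrD lerD //; move: HZ.
  rewrite /= sumset_0 !big_cons big_nil mulr1 => /le_trans; apply.
  rewrite ler_wpM2r //.
  have -> : c = (2 * (2 * (#|sumset A Y1|%:R / #|A|%:R)))
    * (2 * (2 * (#|sumset A Y2|%:R / #|A|%:R))) by rewrite /c; ring.
  by rewrite ler_pM ?mulr_ge0 ?invr_ge0 // ler_wpM2l.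
have /= := A'max _ okU; rewrite disj -[leqRHS]addn0 leq_add2l leqn0 cards_eq0.
by rewrite (negbTE Z0).
Qed.

End Pluennecke.


(** * Dilates with small sumset *)

Section Expansion.
Variables (R : realFieldType) (F : finFieldType) (B : {set F}).
Hypothesis B0 : B != set0.
Implicit Types (X Q : {set F}) (r t x y xi : F).

Definition expansion r : R := #|sumset B (dilate r B)|%:R / #|B|%:R.

Let cB0 : 0 < #|B|%:R :> R. Proof. by rewrite ltr0n card_gt0. Qed.

Lemma expansion_ge1 r : 1 <= expansion r.
Proof.
by rewrite ler_pdivlMr // mul1r ler_nat card_sumset_ge // dilate_eq0.
Qed.

Lemma expansion_gt0 r : 0 < expansion r.
Proof. exact: lt_le_trans ltr01 (expansion_ge1 r). Qed.

Lemma expansion_ge0 r : 0 <= expansion r.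
Proof. exact: ltW (expansion_gt0 r). Qed.

Lemma card_sumset_dilate r : #|sumset B (dilate r B)|%:R = expansion r * #|B|%:R.
Proof. by rewrite divfK // gt_eqF. Qed.

Lemma expansion0 : expansion 0 = 1.
Proof.
rewrite /expansion; have -> : dilate 0 B = [set 0].
  apply/setP=> z; rewrite inE; apply/imsetP/eqP => [[b _ ->]|->].
    by rewrite mul0r.
  by case/set0Pn: B0 => b bB; exists b; rewrite ?mul0r.
by rewrite sumset_0 divff // gt_eqF.
Qed.

Lemma card_sumset_dilate2 r t : r != 0 ->
  #|sumset (dilate r B) (dilate t B)|%:R = expansion (t / r) * #|B|%:R.
Proof.
move=> r0; rewrite -card_sumset_dilate -(card_dilate (sumset B _) r0).
by rewrite dilate_sumset -dilateM mulrC divfK.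
Qed.

Lemma expansionM r t : expansion (r * t) <= 4 * expansion r * expansion t.
Proof.
case: (eqVneq r 0) => [->|r0].
  rewrite mul0r expansion0.
  by have := expansion_ge1 t; have := expansion_ge1 0; nra.
have /= := @pluennecke R _ (dilate r B) [:: B; dilate (r * t) B] (dilate_eq0 r B0).
rewrite !big_cons big_nil mulr1 sumset_0 card_dilate //.
rewrite card_sumset_dilate2 // (sumsetC _ B) !card_sumset_dilate.
rewrite !mulfK ?gt_eqF // ler_pM2r // [r * t / r]mulrAC divff // mul1r.
lra.
Qed.

Hypothesis BN : dilate (-1) B = B.

Lemma expansionN r : expansion (- r) = expansion r.
Proof. by rewrite /expansion -mulrN1 dilateM BN. Qed.

(** [B] itself is the pivot, for the three summands [B], [B] and [r B]. *)
Lemma expansion1D r : expansion (1 + r) <= 27 * expansion 1 ^+ 2 * expansion r.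
Proof.
have /= := @pluennecke R _ B [:: B; B; dilate r B] B0.
rewrite !big_cons big_nil mulr1 sumset_0.
have B1 : #|sumset B B|%:R = expansion 1 * #|B|%:R.
  by rewrite -card_sumset_dilate dilate1.
rewrite B1 card_sumset_dilate !mulfK ?gt_eqF // => H.
rewrite -(ler_pM2r cB0) -card_sumset_dilate.
apply: le_trans (_ : #|sumset B (sumset B (dilate r B))|%:R <= _).
  rewrite ler_nat subset_leq_card // sumsetS //.
  by apply: subset_trans (dilateD_sub _ _ _) _; rewrite dilate1.
by apply: le_trans H _; rewrite ler_pM2r //; lra.
Qed.

(** After multiplication by [c - d], both dilates in question lie in sums of two
    dilates of [B]; [B] is then the pivot for four summands. The symmetry of [B]
    removes the signs. *)
Lemma expansion_quotient a b c d :
  expansion ((a - b) / (c - d))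
    <= 256 * (expansion a * expansion b * expansion c * expansion d).
Proof.
case: (eqVneq (c - d) 0) => [->|cd].
  rewrite invr0 mulr0 expansion0.
  have := expansion_ge1 a; have := expansion_ge1 b.
  have := expansion_ge1 c; have := expansion_ge1 d.
  move=> hd hc hb ha.
  have hab := mulr_ege1 ha hb; have habc := mulr_ege1 hab hc.
  have := mulr_ege1 habc hd; lra.
have /= := @pluennecke R _ B
  [:: dilate c B; dilate (- d) B; dilate a B; dilate (- b) B] B0.
rewrite !big_cons big_nil mulr1 sumset_0 !card_sumset_dilate.
rewrite !mulfK ?gt_eqF // !expansionN => H.
rewrite -(ler_pM2r cB0) -card_sumset_dilate2 //.
apply: le_trans (_ : #|sumset (dilate c B) (sumset (dilate (- d) B)
   (sumset (dilate a B) (dilate (- b) B)))|%:R <= _).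
  by rewrite ler_nat subset_leq_card // sumsetA sumsetS ?dilateD_sub.
apply: le_trans H _; rewrite ler_pM2r //; lra.
Qed.

(** The solutions of [b + r * c = b' + r * c'] in [B] with [c != c'], counted
    as intersections of translates of [B]. *)
Definition crossings r : nat :=
  (\sum_(c in B) \sum_(c' in B | c != c')
     #|sumset B [set (r * c)%R] :&: sumset B [set (r * c')%R]|)%N.

(** A quadruple [(b, b', c, c')] with [c != c'] is a solution of
    [b + r * c = b' + r * c'] for one [r] only. *)
Lemma sum_crossings X : (\sum_(r in X) crossings r <= #|B| ^ 4)%N.
Proof.
rewrite /crossings exchange_big /=.
have -> : (#|B| ^ 4 = #|B| * (#|B| * #|B| ^ 2))%N by rewrite -!expnS.
rewrite -sum_nat_const; apply: leq_sum => c cB.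
rewrite exchange_big /=.
apply: leq_trans (_ : \sum_(c' in B | c != c') #|B| ^ 2 <= _)%N; last first.
  rewrite -sum_nat_const [leqRHS]big_mkcond [leqLHS]big_mkcond /=.
  by apply: leq_sum => c' _; case: (c' \in B); case: (c != c').
apply: leq_sum => c' /andP [c'B cc'].
under eq_bigr => r _ do rewrite -sum1_card.
rewrite pair_big_dep /= sum1dep_card -mulnn -cardsX.
pose g (p : F * F) := (p.2 - p.1 * c, p.2 - p.1 * c').
rewrite -(card_in_imset (f := g)).
  apply/subset_leq_card/subsetP => _ /imsetP [[r e] + ->].
  rewrite !inE /= !sumset1 => /andP [_ /andP [/imsetP [b bB eb] /imsetP [b' b'B eb']]].
  by rewrite {1}eb {1}eb' !addrK bB b'B.
move=> [r e] [r' e'] _ _ [h1 h2].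
have : (r - r') * (c - c') = 0.
  have -> : (r - r') * (c - c')
    = (e - r * c') - (e - r * c) - ((e' - r' * c') - (e' - r' * c)) by ring.
  by rewrite h1 h2 subrr.
move/eqP; rewrite mulf_eq0 !subr_eq0 (negbTE cc') orbF => /eqP rr'.
by move: h1; rewrite rr' => /addIr ->.
Qed.

(** Cauchy-Schwarz for the translates [B' + r * c], [c] in [B], inside
    [B' + r B]; the diagonal [c = c'] contributes the term [#|B| ^ 2]. *)
Lemma crossings_energy (B' : {set F}) r : B' \subset B -> (#|B| <= 2 * #|B'|)%N ->
  (#|B| ^ 4 <= 4 * #|sumset B' (dilate r B)| * (#|B| ^ 2 + crossings r))%N.
Proof.
move=> B'B half.
have := @card_pairwise_inter _ _ B (fun c => sumset B' [set r * c])
  (sumset B' (dilate r B)).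
have sub c : c \in B -> sumset B' [set r * c] \subset sumset B' (dilate r B).
  by move=> cB; rewrite sumsetS // sub1set imset_f.
move=> /(_ sub).
under eq_bigr do rewrite card_sumset1.
rewrite sum_nat_const => H.
have E : (\sum_(i in B) \sum_(j in B)
     #|sumset B' [set (r * i)%R] :&: sumset B' [set (r * j)%R]|
   <= #|B| ^ 2 + crossings r)%N.
  rewrite -mulnn -sum_nat_const -big_split /=; apply: leq_sum => c cB.
  rewrite (bigD1 c) //=; apply: leq_add.
    by rewrite setIid card_sumset1 subset_leq_card.
  rewrite (eq_bigl (fun c' => (c' \in B) && (c != c'))); last first.
    by move=> c'; rewrite eq_sym.
  apply: leq_sum => c' _; apply/subset_leq_card/setISS; exact: sumsetS.
apply: leq_trans (_ : 4 * (#|B| * #|B'|) ^ 2 <= _)%N.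
  by have := leq_mul half half; rewrite -mulnn; nia.
rewrite -mulnA leq_pmul2l //; apply: leq_trans H _.
by rewrite leq_mul2l E orbT.
Qed.

(** When [M] is small compared to [#|B|], the trivial solutions cannot account
    for the energy, so that there are many crossings. *)
Lemma crossings_ge (B' : {set F}) r (M : R) : B' \subset B -> (#|B| <= 2 * #|B'|)%N ->
  #|sumset B' (dilate r B)|%:R <= M * #|B'|%:R -> 8 * M <= #|B|%:R ->
  #|B|%:R ^+ 3 <= 8 * M * (crossings r)%:R.
Proof.
move=> B'B half small Mn.
have n0 := cB0; have := crossings_energy r B'B half.
rewrite -(ler_nat R) !natrM natrD !natrX => H.
have B'n : #|B'|%:R <= #|B|%:R :> R by rewrite ler_nat subset_leq_card.
have B'0 : 0 < #|B'|%:R :> R.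
  have : #|B|%:R <= 2 * #|B'|%:R :> R by rewrite -natrM ler_nat.
  lra.
have M0 : 0 <= M.
  by rewrite -(pmulr_lge0 _ B'0) (le_trans _ small).
have s1 : #|sumset B' (dilate r B)|%:R <= M * #|B|%:R.
  by apply: le_trans small _; rewrite ler_wpM2l.
set n : R := #|B|%:R in n0 Mn H s1 *; set N : R := (crossings r)%:R in H *.
have N0 : 0 <= N by apply: ler0n.
have n2N : 0 <= n ^+ 2 + N by rewrite addr_ge0 // exprn_ge0 // ltW.
have H2 : n ^+ 4 <= 4 * (M * n) * (n ^+ 2 + N).
  by apply: le_trans H _; rewrite ler_wpM2r // ler_wpM2l.
have H3 : n ^+ 3 <= 4 * M * (n ^+ 2 + N).
  by rewrite -(ler_pM2r n0) (le_trans _ (le_trans H2 _)) //; apply: le_of_eq; ring.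
have H4 : 8 * M * n ^+ 2 <= n ^+ 3.
  by rewrite [n ^+ 3]exprS ler_wpM2r // exprn_ge0 // ltW.
lra.
Qed.

(** Each [q] in [Q] has at least [#|B| ^ 3 / (8 * M)] crossings, and all
    crossings together number at most [#|B| ^ 4]. *)
Lemma card_small_expansion Q (M : R) : 0 <= M ->
  (forall q, q \in Q -> expansion q <= M) -> 8 * M <= #|B|%:R ->
  #|Q|%:R <= 8 * M * #|B|%:R.
Proof.
move=> M0 QM Mn.
have : #|Q|%:R * #|B|%:R ^+ 3 <= 8 * M * #|B|%:R ^+ 4.
  apply: le_trans (_ : \sum_(q in Q) 8 * M * (crossings q)%:R <= _).
    rewrite mulr_natl -sumr_const; apply: ler_sum => q qQ.
    apply: (crossings_ge (subxx B)) => //; first by rewrite leq_pmull.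
    by rewrite card_sumset_dilate ler_wpM2r // QM.
  rewrite -mulr_sumr ler_wpM2l ?mulr_ge0 // -natr_sum -natrX ler_nat.
  exact: sum_crossings.
by rewrite [_ ^+ 4]exprS mulrA ler_pM2r ?exprn_gt0.
Qed.

(** The sums [x + xi * y] are pairwise distinct, and each has at least
    [#|B| ^ 3 / (512 * e xi * e x * e y)] crossings, where [e] is the
    expansion; summing over all pairs gives the square on the left. The
    weights [1 / e x] are kept because in the application it is their sum that
    an averaging argument controls; separate bounds for [#|X|] and [e x] would
    lose a power. *)
Lemma expansion_pivot X xi (L : R) :
  (forall x, x \in X -> expansion x <= L) ->
  (forall x y x' y', x \in X -> y \in X -> x' \in X -> y' \in X ->
     x + xi * y = x' + xi * y' -> x = x' /\ y = y') ->
  512 * L ^+ 2 * expansion xi <= #|B|%:R ->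
  (\sum_(x in X) (expansion x)^-1) ^+ 2 <= 512 * expansion xi * #|B|%:R.
Proof.
move=> XL inj big_n.
have cross x y : x \in X -> y \in X ->
    #|B|%:R ^+ 3 * ((expansion x)^-1 * (expansion y)^-1)
      <= 512 * expansion xi * (crossings (x + xi * y))%:R.
  move=> xX yX.
  have ex := expansion_gt0 x; have ey := expansion_gt0 y.
  have exi := expansion_gt0 xi.
  have [B' [B'B half]] := @pluennecke_half R _ B (dilate x B) (dilate (xi * y) B) B0.
  rewrite -/(expansion x) -/(expansion (xi * y)) => small.
  pose M := 64 * (expansion x * expansion y) * expansion xi.
  have : #|B|%:R ^+ 3 <= 8 * M * (crossings (x + xi * y))%:R.
    apply: (crossings_ge B'B half).
      apply: le_trans
        (_ : #|sumset B' (sumset (dilate x B) (dilate (xi * y) B))|%:R <= _).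
        by rewrite ler_nat subset_leq_card // sumsetS // dilateD_sub.
      apply: le_trans small _; rewrite ler_wpM2r // /M.
      have /(ler_wpM2l (ltW ex)) := expansionM xi y; lra.
    apply: le_trans big_n; rewrite /M mulrA ler_pM2r //.
    have := ler_pM (ltW ex) (ltW ey) (XL _ xX) (XL _ yX); lra.
  rewrite -invfM (ler_pdivrMr _ _ (mulr_gt0 ex ey)) => /le_trans; apply.
  by rewrite /M le_eqVlt; apply/orP; left; apply/eqP; ring.
have : #|B|%:R ^+ 3 * (\sum_(x in X) (expansion x)^-1) ^+ 2
    <= 512 * expansion xi * #|B|%:R ^+ 4.
  rewrite expr2 big_distrl mulr_sumr /=.
  apply: le_trans (_ : \sum_(x in X) \sum_(y in X)
      512 * expansion xi * (crossings (x + xi * y))%:R <= _).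
    apply: ler_sum => x xX; rewrite mulr_sumr mulr_sumr.
    by apply: ler_sum => y yX; apply: cross.
  under eq_bigr do rewrite -mulr_sumr.
  have c0 : 0 <= 512 * expansion xi by have := expansion_gt0 xi; lra.
  rewrite -mulr_sumr ler_wpM2l //.
  rewrite pair_big /= -natr_sum -natrX ler_nat.
  pose g (p : F * F) := p.1 + xi * p.2.
  rewrite (eq_bigl (mem (setX X X))); last by move=> p; rewrite !inE.
  rewrite -(big_imset crossings (h := g)) /=; first exact: sum_crossings.
  move=> [x y] [x' y']; rewrite !inE /= => /andP [xX yX] /andP [x'X y'X] e.
  by have [-> ->] := inj _ _ _ _ xX yX x'X y'X e.
move=> H; rewrite -(ler_pM2l (exprn_gt0 3 cB0)); apply: le_trans H _.
by apply: le_of_eq; ring.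
Qed.

End Expansion.


(** * Ratio sets, subfields and squares *)

Section RatioSet.
Variable F : finFieldType.
Implicit Types (X G P : {set F}).

Definition ratio_set X : {set F} :=
  [set (p.1 - p.2) / (q.1 - q.2) | p in setX X X, q in setX X X].

Lemma ratio_setP X z :
  reflect (exists a b c d, [/\ a \in X, b \in X, c \in X, d \in X &
                               z = (a - b) / (c - d)])
          (z \in ratio_set X).
Proof.
apply: (iffP imset2P) => [[[a b] [c d]]|[a [b [c [d [aX bX cX dX ->]]]]]].
  by rewrite !inE /= => /andP [aX bX] /andP [cX dX] ->; exists a, b, c, d.
by exists (a, b) (c, d); rewrite ?inE /= ?aX ?bX ?cX ?dX.
Qed.

(** A coincidence [x + xi * y = x' + xi * y'] with [y != y'] would express [xi]
    as a ratio of differences. *)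
Lemma ratio_set_inj X xi x y x' y' : xi \notin ratio_set X ->
  x \in X -> y \in X -> x' \in X -> y' \in X ->
  x + xi * y = x' + xi * y' -> x = x' /\ y = y'.
Proof.
move=> xiQ xX yX x'X y'X e.
case: (eqVneq y y') => [yy'|yy']; first by move: e; rewrite yy' => /addIr ->.
case/negP: xiQ; apply/ratio_setP; exists x, x', y', y; split=> //.
have dy : y' - y != 0 by rewrite subr_eq0 eq_sym.
apply: (mulIf dy); rewrite divfK // mulrBr.
have -> : xi * y' = x + xi * y - x' by rewrite e addrC addKr.
by ring.
Qed.

(** The periods of the ratio set [Q] (the [g] with [g + Q] inside [Q]) form an
    additive group, and its multipliers form a subring [G], which is a field by
    finiteness. If [x] is in [X], then [x * h + q = x * (h + q / x)] shows that
    [x] is a multiplier; hence [Q], made of quotients of differences of such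
    [x], lies in [G]. Conversely 1 is a period, so a multiplier [g] is itself a
    period, and lies in [Q] because 0 does. *)
Lemma ratio_set_subfield X : X != set0 -> 0 \notin X ->
  (forall x q, x \in X -> q \in ratio_set X -> x * q \in ratio_set X) ->
  (forall q, q \in ratio_set X -> 1 + q \in ratio_set X) ->
  subfield (ratio_set X) /\ X \subset ratio_set X.
Proof.
move=> /set0Pn [x0 x0X] X0 mulQ addQ; set Q := ratio_set X.
have Q0 : 0 \in Q.
  by apply/ratio_setP; exists x0, x0, x0, x0; split=> //; rewrite !subrr mul0r.
have QN q : q \in Q -> - q \in Q.
  move=> /ratio_setP [a [b [c [d [aX bX cX dX ->]]]]].
  by apply/ratio_setP; exists b, a, c, d; split=> //; rewrite -mulNr opprB.
have QV q : q \in Q -> q^-1 \in Q.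
  move=> /ratio_setP [a [b [c [d [aX bX cX dX ->]]]]].
  by apply/ratio_setP; exists c, d, a, b; split=> //; rewrite invf_div.
have divQ x q : x \in X -> q \in Q -> x^-1 * q \in Q.
  move=> xX qQ; rewrite -[x^-1 * q]invrK invfM invrK.
  by apply/QV/mulQ => //; apply: QV.
pose periods := [set g | [forall q in Q, g + q \in Q]].
pose G := [set g | [forall h in periods, g * h \in periods]].
have periodsP g : reflect (forall q, q \in Q -> g + q \in Q) (g \in periods).
  by rewrite inE; apply: forall_inP.
have GP g : reflect (forall h, h \in periods -> g * h \in periods) (g \in G).
  by rewrite inE; apply: forall_inP.
have periodsD g h : g \in periods -> h \in periods -> g + h \in periods.
  move=> /periodsP gP /periodsP hP; apply/periodsP => q qQ.
  by rewrite -addrA gP // hP.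
have periodsN g : g \in periods -> - g \in periods.
  move=> /periodsP gP; apply/periodsP => q qQ.
  by rewrite -[- g + q]opprK opprD opprK QN // gP // QN.
have G1 : 1 \in G by apply/GP => h; rewrite mul1r.
have GM g h : g \in G -> h \in G -> g * h \in G.
  by move=> /GP gG /GP hG; apply/GP => k kP; rewrite -mulrA gG // hG.
have GB g h : g \in G -> h \in G -> g - h \in G.
  move=> /GP gG /GP hG; apply/GP => k kP.
  by rewrite mulrBl periodsD ?periodsN ?gG ?hG.
have GV g : g \in G -> g^-1 \in G.
  move=> gG; case: (eqVneq g 0) => [->|g0]; first by rewrite invr0 -(subrr 1) GB.
  have -> : g^-1 = g ^+ (#|F| - 2).
    apply: (mulIf g0); rewrite mulVf // -exprSr.
    apply: (mulIf g0); rewrite mul1r -exprSr.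
    have -> : (#|F| - 2).+2 = #|F| by rewrite -addn2 subnK // card_finNzRing_gt1.
    by rewrite expf_card.
  by elim: (_ - _)%N => [|k IH]; rewrite ?expr0 ?exprS ?GM.
have XG x : x \in X -> x \in G.
  move=> xX; apply/GP => h /periodsP hP; apply/periodsP => q qQ.
  have x0' : x != 0 by apply: contraNneq X0 => <-.
  have -> : x * h + q = x * (h + x^-1 * q) by rewrite mulrDr mulVKf.
  by rewrite mulQ // hP // divQ.
have QG : Q \subset G.
  apply/subsetP => _ /ratio_setP [a [b [c [d [aX bX cX dX ->]]]]].
  by apply: GM; [|apply: GV]; apply: GB; apply: XG.
have GQ : G \subset Q.
  apply/subsetP => g /GP gG.
  have one : 1 \in periods by apply/periodsP.
  by have /periodsP /(_ 0 Q0) := gG 1 one; rewrite mulr1 addr0.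
have -> : Q = G by apply/eqP; rewrite eqEsubset QG GQ.
split; last by apply/subsetP.
by split=> // g h gG hG; apply: GM => //; apply: GV.
Qed.

Definition squares P : {set F} := [set y ^+ 2 | y in P].

(** Squaring is at most two-to-one. *)
Lemma sum_squares (R : numDomainType) P (g : F -> R) : (forall x, 0 <= g x) ->
  \sum_(y in P) g (y ^+ 2) <= 2 * \sum_(x in squares P) g x.
Proof.
move=> g0; rewrite (partition_big_imset (fun y => y ^+ 2)) /= mulr_sumr.
apply: ler_sum => x /imsetP [y0 y0P ->].
rewrite (eq_bigr (fun=> g (y0 ^+ 2))); last by move=> y /andP [_ /eqP ->].
rewrite sumr_const mulr_natl ler_wpMn2l //.
apply: leq_trans (_ : #|[set y0; - y0]| <= _)%N; last by rewrite cards2; case: eqP.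
apply/subset_leq_card/subsetP => y; rewrite inE => /andP [_].
by rewrite eqf_sqr !inE.
Qed.

Lemma card_squares P : (#|P| <= 2 * #|squares P|)%N.
Proof.
have := @sum_squares int P (fun=> 1) (fun=> ler01).
by rewrite !sumr_const -[2]/(2%:R) -natrM ler_nat.
Qed.

(** The nonzero [z] with [z ^+ 2] in [G] form a group [Z] that contains the
    multiplicative group [H] of [G], with index at most 2 because squaring is
    at most two-to-one. So [P] is covered by at most two cosets of [H]; the
    proof averages [#|P :&: w H|] over [w] in [Z]. *)
Lemma squares_in_subfield G P : subfield G -> 0 \notin P ->
  squares P \subset G -> exists2 w, w != 0 & (#|P| <= 2 * #|P :&: dilate w G|)%N.
Proof.
move=> [G1 GB Gdiv] P0 /subsetP PG.
pose H := G :\ 0; pose Z := [set z | (z != 0) && (z ^+ 2 \in G)].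
have G0 : 0 \in G by rewrite -(subrr 1) GB.
have GV g : g \in G -> g^-1 \in G by move=> gG; rewrite -[g^-1]mul1r Gdiv.
have GM g h : g \in G -> h \in G -> g * h \in G.
  by move=> gG hG; rewrite -[h]invrK Gdiv // GV.
have ZH : (#|Z| <= 2 * #|H|)%N.
  apply: leq_trans (card_squares Z) _; rewrite leq_pmul2l //.
  apply/subset_leq_card/subsetP => _ /imsetP [z + ->].
  by rewrite !inE => /andP [z0 ->]; rewrite expf_neq0.
have Z1 : 1 \in Z by rewrite inE oner_neq0 expr1n.
have PZ p : p \in P -> p != 0 /\ p ^+ 2 \in G.
  by move=> pP; split; [apply: contraNneq P0 => <-|apply/PG/imset_f].
have double : (\sum_(w in Z) #|P :&: dilate w H| = #|P| * #|H|)%N.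
  under eq_bigr => w _ do rewrite -sum1_card.
  rewrite (exchange_big_dep (mem P)) /=; last by move=> w p _ /setIP [].
  rewrite -sum_nat_const; apply: eq_bigr => p pP.
  have [p0 p2] := PZ p pP.
  rewrite sum1dep_card -(card_dilate H p0); apply: eq_card => w.
  rewrite !inE; apply/andP/imsetP.
    move=> [/andP [w0 w2] /andP [_ /imsetP [h]]].
    rewrite !inE => /andP [h0 hG] ph; exists h^-1; last by rewrite ph mulfK.
    by rewrite !inE invr_eq0 h0 GV.
  move=> [h]; rewrite !inE => /andP [h0 hG] ->.
  have h2 : h ^+ 2 \in G by rewrite expr2 GM.
  rewrite mulf_neq0 // exprMn GM // pP; split=> //=.
  by apply/imsetP; exists h^-1; rewrite ?mulfK // !inE invr_eq0 h0 GV.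
have H0 : (0 < #|H|)%N.
  by rewrite card_gt0; apply/set0Pn; exists 1; rewrite !inE oner_neq0.
have [w wZ wP] : exists2 w, w \in Z & (#|P| <= 2 * #|P :&: dilate w H|)%N.
  apply/exists_inP; apply: contraT; rewrite negb_exists_in => /forall_inP small.
  have : (\sum_(w in Z) (2 * #|P :&: dilate w H|).+1 <= \sum_(w in Z) #|P|)%N.
    by apply: leq_sum => w wZ; rewrite ltnNge small.
  rewrite sum_nat_const; under eq_bigr do rewrite -addn1.
  rewrite big_split /= -big_distrr /= double sum1_card.
  have : (0 < #|Z|)%N by rewrite card_gt0; apply/set0Pn; exists 1.
  have := leq_mul ZH (leqnn #|P|); rewrite -mulnA (mulnC #|H|).
  move=> le1 Z0 le2; have := leq_trans le2 le1.
  by rewrite -[leqRHS]addn0 leq_add2l leqNgt Z0.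
exists w; first by move: wZ; rewrite inE => /andP [].
apply: leq_trans wP _; rewrite leq_pmul2l //.
by apply/subset_leq_card/setIS/imsetS/subD1set.
Qed.

End RatioSet.

(** * The ratio set of slowly expanding elements *)

Section RatioSetExpansion.
Variables (R : realFieldType) (F : finFieldType) (B : {set F}).
Hypotheses (B0 : B != set0) (BN : dilate (-1) B = B).

(** Elements of [X] have expansion at most [L], so those of the ratio set [Q]
    have expansion at most [256 * L ^+ 4], and any [x * q] or [1 + q] has
    expansion at most [2 ^+ 13 * L ^+ 5]. If one of these were outside [Q],
    [expansion_pivot] would bound [(n / (2 * L)) ^+ 2] by a multiple of
    [L ^+ 5 * n], which is the first alternative. Otherwise [Q] is a subfield,
    and a set of elements of expansion at most [256 * L ^+ 4] is not much
    larger than [B]. *)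
Lemma ratio_set_dichotomy (X : {set F}) (L : R) : X != set0 -> 0 \notin X ->
  (forall x, x \in X -> expansion R B x <= L) ->
  expansion R B 1 ^+ 2 <= L ->
  #|B|%:R <= 2 * L * \sum_(x in X) (expansion R B x)^-1 ->
  #|B|%:R <= 2 ^+ 24 * L ^+ 7 \/
  [/\ subfield (ratio_set X), X \subset ratio_set X
    & #|ratio_set X|%:R <= 2 ^+ 11 * L ^+ 4 * #|B|%:R].
Proof.
move=> Xne X0 XL KL sumX; set sigma := \sum_(x in X) _ in sumX.
set n : R := #|B|%:R in sumX *.
have n0 : 0 < n by rewrite ltr0n card_gt0.
have L1 : 1 <= L.
  have := expansion_ge1 R B0 1; nra.
have L0 : 0 <= L by lra.
have L1k k : 1 <= L ^+ k by rewrite exprn_ege1.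
case: (leP n (2 ^+ 24 * L ^+ 7)) => [|big]; [by left|right].
have e0 x : 0 <= expansion R B x by apply: expansion_ge0.
have xiQ xi : expansion R B xi <= 2 ^+ 13 * L ^+ 5 -> xi \in ratio_set X.
  move=> xiL; apply: contraT => xiX.
  have big_n : 512 * L ^+ 2 * expansion R B xi <= n.
    have : 512 * L ^+ 2 * expansion R B xi <= 512 * L ^+ 2 * (2 ^+ 13 * L ^+ 5).
      by rewrite ler_wpM2l // mulr_ge0 // exprn_ge0.
    have -> : 512 * L ^+ 2 * (2 ^+ 13 * L ^+ 5) = 2 ^+ 22 * L ^+ 7 by ring.
    by have := L1k 7; lra.
  have := expansion_pivot B0 XL (fun x y x' y' => ratio_set_inj xiX) big_n.
  rewrite -/sigma -/n => sig.
  have s1 : sigma ^+ 2 <= 512 * (2 ^+ 13 * L ^+ 5) * n.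
    by apply: le_trans sig _; rewrite ler_wpM2r ?(ltW n0) // ler_wpM2l.
  have : n ^+ 2 <= 4 * L ^+ 2 * (512 * (2 ^+ 13 * L ^+ 5) * n).
    apply: le_trans (_ : (2 * L * sigma) ^+ 2 <= _).
      by rewrite !expr2 ler_pM // ltW.
    have -> : (2 * L * sigma) ^+ 2 = 4 * L ^+ 2 * sigma ^+ 2 by ring.
    by rewrite ler_wpM2l // mulr_ge0 // exprn_ge0.
  have -> : 4 * L ^+ 2 * (512 * (2 ^+ 13 * L ^+ 5) * n) = 2 ^+ 24 * L ^+ 7 * n by ring.
  by rewrite expr2 ler_pM2r // leNgt big.
have QL q : q \in ratio_set X -> expansion R B q <= 256 * L ^+ 4.
  move=> /ratio_setP [a [b [c [d [aX bX cX dX ->]]]]].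
  apply: le_trans (expansion_quotient R B0 BN a b c d) _.
  rewrite ler_wpM2l //; have -> : L ^+ 4 = L * L * L * L by ring.
  have eab := mulr_ge0 (e0 a) (e0 b); have eabc := mulr_ge0 eab (e0 c).
  apply: (ler_pM eabc (e0 d) _ (XL d dX)).
  apply: (ler_pM eab (e0 c) _ (XL c cX)).
  exact: (ler_pM (e0 a) (e0 b) (XL a aX) (XL b bX)).
have L45 : L ^+ 4 <= L ^+ 5 by rewrite ler_weXn2l.
have [sub XQ] : subfield (ratio_set X) /\ X \subset ratio_set X.
  apply: ratio_set_subfield => // [x q xX qQ|q qQ]; apply: xiQ.
    apply: le_trans (expansionM R B0 x q) _.
    apply: le_trans (_ : 4 * L * (256 * L ^+ 4) <= _).
      by apply: ler_pM; rewrite ?(QL q qQ) ?e0 ?ler_wpM2l ?XL ?(mulr_ge0 _ (e0 x)).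
    have -> : 4 * L * (256 * L ^+ 4) = 2 ^+ 10 * L ^+ 5 by ring.
    by have := L1k 5%N; lra.
  apply: le_trans (expansion1D R B0 q) _.
  apply: le_trans (_ : 27 * L * (256 * L ^+ 4) <= _).
    by apply: ler_pM; rewrite ?(QL q qQ) ?e0 ?ler_wpM2l // mulr_ge0 // exprn_ge0.
  have := L1k 5%N; have -> : 27 * L * (256 * L ^+ 4) = 6912 * L ^+ 5 by ring.
  by lra.
split=> //.
have -> : 2 ^+ 11 * L ^+ 4 = 8 * (256 * L ^+ 4) by ring.
apply: (card_small_expansion B0 _ QL); first by rewrite mulr_ge0 // exprn_ge0.
rewrite -/n; have : L ^+ 4 <= L ^+ 7 by rewrite ler_weXn2l.
have := L1k 4%N; lra.
Qed.

End RatioSetExpansion.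


(** * Reciprocals of an additive subgroup *)

Section Reciprocals.
Variables (F : finFieldType) (A : {set F}).
Hypotheses (Asub : additive_subgroup A) (A2 : (2 <= #|A|)%N).

Local Notation B := (inv_set A).
Local Notation S := (sumset B B).

Let A0 : 0 \in A. Proof. by case: Asub. Qed.
Let AB x y : x \in A -> y \in A -> x - y \in A.
Proof. by case: Asub => _; apply. Qed.
Let AN x : x \in A -> - x \in A.
Proof. by move=> xA; rewrite -sub0r AB. Qed.
Let AD x y : x \in A -> y \in A -> x + y \in A.
Proof. by move=> xA yA; rewrite -[y]opprK AB // AN. Qed.

Lemma mem_inv_set b : (b \in B) = (b != 0) && (b^-1 \in A).
Proof.
apply/imsetP/andP => [[x]|[b0 bA]].
  by rewrite inE => /andP [xA x0] ->; rewrite invr_eq0 invrK.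
by exists b^-1; rewrite ?invrK // inE bA invr_eq0.
Qed.

Lemma card_inv_set : #|A| = #|B|.+1.
Proof.
rewrite (cardsD1 0) A0 add1n card_imset; last exact: invr_inj.
by congr _.+1; apply: eq_card => x; rewrite !inE andbC.
Qed.

Lemma inv_set_neq0 : B != set0.
Proof. by rewrite -card_gt0; move: A2; rewrite card_inv_set. Qed.

Lemma inv_setN : dilate (-1) B = B.
Proof.
apply/setP=> b; apply/imsetP/idP => [[c]|].
  move=> cB ->; move: cB; rewrite !mem_inv_set mulN1r => /andP [c0 cA].
  by rewrite oppr_eq0 c0 invrN AN.
rewrite mem_inv_set => /andP [b0 bA]; exists (- b); last by rewrite mulN1r opprK.
by rewrite mem_inv_set oppr_eq0 b0 invrN AN.
Qed.

Lemma opp_inv_set b : b \in B -> - b \in B.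
Proof.
by move=> bB; rewrite -inv_setN; apply/imsetP; exists b; rewrite ?mulN1r.
Qed.

Lemma diffset_inv_set : diffset B B = S.
Proof.
apply/setP=> z; apply/imset2P/imset2P => -[x y xB yB ->];
  by exists x (- y); rewrite ?opprK ?opp_inv_set.
Qed.

(** For nonzero [x] in [A], and with the convention that 0 is its own inverse,
    this is the set of reciprocals of the elements of [x^-1 + B]: indeed
    [1 / (1 / x + 1 / u) = x - x ^+ 2 / (x + u)], and [x + u] runs through [A]
    with [u]. *)
Definition reciprocal_shift (x : F) : {set F} := sumset (dilate (x ^+ 2) B) [set x].

(** If [b = 1 / u], then [x + x ^+ 2 * b = x * (x + u) / u] is the reciprocal
    of [1 / x - 1 / (x + u)], and [x + u] is in [A]. Here closure of [A]
    under addition enters. *)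
Lemma reciprocal_shift_sub x : x \in A :\ 0 ->
  reciprocal_shift x \subset [set s^-1 | s in S].
Proof.
rewrite !inE => /andP [x0 xA]; apply/subsetP => z.
rewrite /reciprocal_shift sumset1 => /imsetP [_ /imsetP [b bB ->] ->].
have bB' := bB; move: bB'; rewrite mem_inv_set => /andP [b0 bA].
(* When [x + u = 0] the element is 0, which is the inverse of [0 = b - b]. *)
case: (eqVneq (x + b^-1) 0) => [e|ne].
  apply/imsetP; exists 0.
    by rewrite -(subrr b) mem_sumset // opp_inv_set.
  have -> : b = - x^-1.
    by rewrite -invrN -[LHS]invrK; congr _^-1; apply/eqP; rewrite -addr_eq0 addrC e.
  by rewrite invr0; field.
apply/imsetP; exists (x^-1 + (- (x + b^-1))^-1).
  by rewrite mem_sumset // mem_inv_set invrK ?invr_eq0 ?x0 ?xA // oppr_eq0 ne AN // AD.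
have xb : x * b + 1 != 0.
  apply: contraNneq ne => e; apply/eqP/(mulIf b0).
  by rewrite mulrDl mulVf // mul0r.
field; have -> : - (x * b + 1) + b * x = -1 by ring.
by rewrite x0 b0 !oppr_eq0 xb oner_neq0.
Qed.

Lemma card_reciprocal_shift x : x != 0 -> #|reciprocal_shift x| = #|B|.
Proof. by move=> x0; rewrite card_sumset1 card_dilate // expf_neq0. Qed.

(** The [#|B|] sets of size [#|B|] given by [reciprocal_shift] lie in a set of
    size at most [#|S|], so they meet each other often on average. *)
Lemma popular_shift : exists2 x0, x0 \in A :\ 0 &
  (#|B| ^ 3 <= #|S| *
     \sum_(y in A :\ 0%R) #|reciprocal_shift x0 :&: reciprocal_shift y|)%N.
Proof.
have cA : #|A :\ 0| = #|B| by have := card_inv_set; rewrite (cardsD1 0 A) A0 => -[].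
have := card_pairwise_inter reciprocal_shift_sub.
rewrite (eq_bigr (fun=> #|B|)); last first.
  by move=> x; rewrite !inE => /andP [x0 _]; rewrite card_reciprocal_shift.
rewrite sum_nat_const cA => H.
apply/exists_inP; apply: contraT; rewrite negb_exists_in => /forall_inP small.
have : (\sum_(x in A :\ 0%R) (#|S| *
     \sum_(y in A :\ 0%R) #|reciprocal_shift x :&: reciprocal_shift y|).+1
   <= \sum_(x in A :\ 0%R) #|B| ^ 3)%N.
  by apply: leq_sum => x xA; rewrite ltnNge small.
rewrite sum_nat_const cA; under eq_bigr do rewrite -addn1.
rewrite big_split /= sum1_card cA -big_distrr /= => H2.
have H3 : (#|[set s^-1 | s in S]| <= #|S|)%N by apply: leq_imset_card.
have B0 : (0 < #|B|)%N by rewrite card_gt0 inv_set_neq0.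
have := leq_trans H (leq_mul H3 (leqnn _)); rewrite mulnn -expnM => H4.
have := leq_trans H2 H4; rewrite -[leqRHS]addn0.
by rewrite leq_add2l leqNgt B0.
Qed.

Section Weights.
Variable R : realFieldType.
Local Notation e := (expansion R B).
Local Notation K := (e 1).

Lemma card_sumset_inv_set : #|S|%:R = K * #|B|%:R.
Proof. by rewrite -card_sumset_dilate ?dilate1 ?inv_set_neq0. Qed.

(** The intersection [T] of the two sets is the pivot: it lies in translates of
    both [x ^+ 2 B] and [y ^+ 2 B], so adding either dilate to it gives at most
    [#|S|] elements. *)
Lemma expansion_popular x y : x != 0 -> y != 0 ->
  e ((y / x) ^+ 2) * (#|reciprocal_shift x :&: reciprocal_shift y|%:R * #|B|%:R)
    <= 4 * #|S|%:R ^+ 2.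
Proof.
move=> x0 y0; set T := _ :&: _.
have B0 := inv_set_neq0.
case: (eqVneq T set0) => [->|T0].
  by rewrite cards0 mul0r mulr0 mulr_ge0 // exprn_ge0.
have cT0 : 0 < #|T|%:R :> R by rewrite ltr0n card_gt0.
have := @pluennecke R _ T [:: dilate (x ^+ 2) B; dilate (y ^+ 2) B] T0.
rewrite /= !big_cons big_nil mulr1 sumset_0.
rewrite card_sumset_dilate2 ?expf_neq0 // -expr_div_n => H.
have TS z : z != 0 -> T \subset reciprocal_shift z ->
    #|sumset T (dilate (z ^+ 2) B)|%:R <= #|S|%:R :> R.
  move=> z0 Tz; rewrite ler_nat.
  apply: leq_trans (_ : #|sumset (reciprocal_shift z) (dilate (z ^+ 2) B)| <= _)%N.
    by apply/subset_leq_card/sumsetS.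
  rewrite /reciprocal_shift -sumsetA (sumsetC [set z]) sumsetA card_sumset1.
  by rewrite -dilate_sumset card_dilate // expf_neq0.
have T1 := TS x x0 (subsetIl _ _); have T2 := TS y y0 (subsetIr _ _).
rewrite mulrCA -ler_pdivlMl // (le_trans H) //.
set a := #|sumset T (dilate (x ^+ 2) B)|%:R in T1 *.
set b := #|sumset T (dilate (y ^+ 2) B)|%:R in T2 *.
have -> : 2 * (a / #|T|%:R) * (2 * (b / #|T|%:R)) * #|T|%:R = #|T|%:R^-1 * (4 * (a * b)).
  by field; rewrite gt_eqF.
by rewrite ler_wpM2l ?invr_ge0 // ler_wpM2l // expr2 ler_pM.
Qed.

(** Take [x0] from [popular_shift] and keep the [y] for which the intersection
    [tau y] with the set of [x0] has at least half of the average size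
    [#|B| / K]. By [expansion_popular], [1 / e ((y / x0) ^+ 2)] is at least
    [tau y / (4 * K ^+ 2 * #|B|)], so the lower bounds for [tau], pointwise and
    on average, become the last two claims; the first one holds because no
    [tau y] exceeds [#|B|]. *)
Lemma popular_squares : exists (x0 : F) (P : {set F}),
  [/\ x0 != 0, 0 \notin P, dilate x0 P \subset A &
  [/\ #|B|%:R <= 2 * K * #|P|%:R,
      forall x, x \in squares P -> e x <= 8 * K ^+ 3
    & #|B|%:R <= 16 * K ^+ 3 * \sum_(x in squares P) (e x)^-1]].
Proof.
have [x0 x0A pop] := popular_shift.
have B0 := inv_set_neq0.
pose tau y : R := #|reciprocal_shift x0 :&: reciprocal_shift y|%:R.
have n0 : 0 < #|B|%:R :> R by rewrite ltr0n card_gt0.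
have K1 : 1 <= K := expansion_ge1 R B0 1.
have xn0 : x0 != 0 by move: x0A; rewrite !inE => /andP [].
set n : R := #|B|%:R in n0.
have pop' : n ^+ 2 <= K * \sum_(y in A :\ 0) tau y.
  move: pop; rewrite -(ler_nat R) natrX natrM natr_sum.
  rewrite card_sumset_inv_set -/n => H.
  rewrite -(ler_pM2r n0) -exprSr; apply: le_trans H _.
  by apply: le_of_eq; rewrite /tau; ring.
pose P0 := [set y in A :\ 0 | n <= 2 * K * tau y].
have popP : n ^+ 2 <= 2 * K * \sum_(y in P0) tau y.
  have cA : #|A :\ 0| = #|B| by have := card_inv_set; rewrite (cardsD1 0 A) A0 => -[].
  have : 2 * K * \sum_(y in A :\ 0) tau y <= 2 * K * \sum_(y in P0) tau y + n ^+ 2.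
    have -> : n ^+ 2 = \sum_(y in A :\ 0) n by rewrite sumr_const cA -mulr_natr -/n expr2.
    rewrite (bigID (fun y => n <= 2 * K * tau y)) /= mulrDr lerD //.
      rewrite ler_wpM2l //; first lra.
      by apply: le_of_eq; apply: eq_bigl => y; rewrite !inE.
    rewrite mulr_sumr [leLHS]big_mkcondr /=; apply: ler_sum => y _.
    by case: ifP => [|_]; [rewrite -ltNge => /ltW | exact: ltW].
  lra.
exists x0, (dilate x0^-1 P0); split=> //.
- apply/imsetP => -[y]; rewrite !inE => /andP [/andP [y0 _] _] /eqP.
  by rewrite eq_sym mulf_eq0 invr_eq0 (negbTE xn0) (negbTE y0).
- rewrite -dilateM divff // dilate1; apply/subsetP => y.
  by rewrite !inE => /andP [/andP []].
have bound y : y \in A :\ 0 -> e ((y / x0) ^+ 2) * tau y <= 4 * K ^+ 2 * n.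
  rewrite !inE => /andP [y0 _]; have := expansion_popular xn0 y0.
  rewrite -/(tau y) card_sumset_inv_set -/n => H.
  rewrite -(ler_pM2r n0); lra.
have eL y : y \in P0 -> e ((y / x0) ^+ 2) <= 8 * K ^+ 3.
  rewrite inE => /andP [yA ty]; have := bound y yA.
  have := expansion_ge0 R B0 ((y / x0) ^+ 2) => e0 H.
  have := ler_wpM2l e0 ty => H2.
  have K0 : 0 <= 2 * K by lra.
  have := ler_wpM2l K0 H => H3.
  rewrite -(ler_pM2r n0).
  apply: le_trans H2 _; apply: le_trans (_ : 2 * K * (4 * K ^+ 2 * n) <= _).
    by apply: le_trans H3; rewrite mulrCA.
  by apply: le_of_eq; ring.
split.
- rewrite card_dilate ?invr_eq0 // -(ler_pM2r n0) -expr2; apply: le_trans popP _.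
  rewrite -[leRHS]mulrA ler_wpM2l //; first lra.
  rewrite [leRHS]mulrC mulr_natr -sumr_const; apply: ler_sum => y.
  rewrite inE => /andP [yA _]; rewrite ler_nat.
  apply: leq_trans (subset_leq_card (subsetIl _ _)) _.
  by rewrite card_reciprocal_shift.
- by move=> _ /imsetP [_ /imsetP [y yP ->] ->]; rewrite mulrC eL.
have w0 x : 0 <= (e x)^-1 by rewrite invr_ge0 expansion_ge0.
have := sum_squares (dilate x0^-1 P0) w0.
rewrite big_imset /=; last by move=> y z _ _; apply: mulfI; rewrite invr_eq0.
set sigma := \sum_(x in squares _) _ => sig.
have tw y : y \in P0 -> tau y <= 4 * K ^+ 2 * n * (e ((x0^-1 * y) ^+ 2))^-1.
  rewrite inE => /andP [yA _].
  rewrite ler_pdivlMr ?expansion_gt0 // mulrC [x0^-1 * y]mulrC.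
  exact: bound.
have : \sum_(y in P0) tau y <= 4 * K ^+ 2 * n * (2 * sigma).
  apply: le_trans (_ : \sum_(y in P0) 4 * K ^+ 2 * n * (e ((x0^-1 * y) ^+ 2))^-1 <= _).
    exact: ler_sum.
  rewrite -mulr_sumr ler_wpM2l //; apply: mulr_ge0; last exact: ltW.
  by apply: mulr_ge0 => //; apply: exprn_ge0; lra.
have K0 : 0 <= 2 * K by lra.
move=> /(ler_wpM2l K0) H; rewrite -(ler_pM2r n0) -expr2.
apply: le_trans popP _; apply: le_trans H _.
by apply: le_of_eq; ring.
Qed.

(** The dichotomy for the ratio set of the popular squares, with
    [L = 8 * K ^+ 3]. In the second case the squares lie in a subfield [G], so
    half of their roots lie in one dilate of [G]; these are, up to the factor
    [x0], elements of [A], and inverting them gives elements of [B]. *)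
Lemma expansion_or_subfield :
  #|B|%:R <= 2 ^+ 45 * K ^+ 21 \/
  exists (G : {set F}) (w : F), [/\ subfield G,
    #|B|%:R <= 4 * K * #|G|%:R, #|G|%:R <= 2 ^+ 23 * K ^+ 12 * #|B|%:R
    & #|B|%:R <= 4 * K * #|B :&: affine_image w G 0|%:R].
Proof.
have [x0 [P [x00 P0 PA [nP eL sig]]]] := popular_squares.
have B0 := inv_set_neq0.
have n0 : 0 < #|B|%:R :> R by rewrite ltr0n card_gt0.
have K1 : 1 <= K := expansion_ge1 R B0 1.
have Kpos : 0 < 2 * K by lra.
have Pne : P != set0.
  by rewrite -card_gt0 -(ltr0n R) -(pmulr_rgt0 _ Kpos) (lt_le_trans n0).
have sqne : squares P != set0.
  by case/set0Pn: Pne => y yP; apply/set0Pn; exists (y ^+ 2); apply: imset_f.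
have sq0 : 0 \notin squares P.
  apply/imsetP => -[y yP /eqP]; rewrite eq_sym sqrf_eq0 => /eqP y0.
  by move: P0; rewrite -y0 yP.
have KL : K ^+ 2 <= 8 * K ^+ 3.
  have : K ^+ 2 <= K ^+ 3 by rewrite ler_weXn2l.
  have : 0 <= K ^+ 3 by rewrite exprn_ge0 //; lra.
  lra.
have sig' : #|B|%:R <= 2 * (8 * K ^+ 3) * \sum_(x in squares P) (e x)^-1.
  by rewrite mulrA; have -> : 2 * 8 = 16 :> R by ring.
have [big|[sub XQ cQ]] := ratio_set_dichotomy B0 inv_setN sqne sq0 eL KL sig'.
  left; apply: le_trans big _.
  by apply: le_of_eq; ring.
right; set G := ratio_set _ in sub XQ cQ.
have [w w0 Pw] := squares_in_subfield sub P0 XQ.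
have KPle m : (#|P| <= 2 * m)%N -> #|B|%:R <= 4 * K * m%:R.
  move=> Pm; apply: le_trans nP _.
  have -> : 4 * K * m%:R = 2 * K * (2 * m)%:R by rewrite natrM; ring.
  by rewrite ler_wpM2l ?ler_nat // ltW.
exists G, (x0 * w)^-1; split=> //.
- apply: KPle; apply: leq_trans (card_squares P) _.
  by rewrite leq_pmul2l // subset_leq_card.
- by apply: le_trans cQ _; apply: le_of_eq; ring.
apply: KPle; apply: leq_trans Pw _; rewrite leq_pmul2l //.
have inj : injective (fun p => (x0 * p)^-1) by move=> p q /invr_inj /(mulfI x00).
rewrite -(card_imset _ inj); apply/subset_leq_card/subsetP => _ /imsetP [p + ->].
rewrite !inE => /andP [pP /imsetP [g gG pw]].
rewrite mem_inv_set invrK invr_eq0 mulf_neq0 //=; last first.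
  by apply: contraNneq P0 => <-.
apply/andP; split; first by apply: (subsetP PA); apply: imset_f.
apply/imsetP; exists g^-1; last by rewrite pw mulrA invfM addr0.
by case: sub => G1 _ Gdiv; rewrite -[g^-1]mul1r Gdiv.
Qed.

End Weights.
End Reciprocals.


(** * Real exponents and the growth estimate *)

Section GrowthEstimate.
Variables (R : realType).

Lemma powR_exprn (x r : R) (k m : nat) : 0 <= x -> r * k%:R = m%:R ->
  (x `^ r) ^+ k = x ^+ m.
Proof.
by move=> x0 e; rewrite -powR_mulrn ?powR_ge0 // -powRrM e powR_mulrn.
Qed.

(** The second factor absorbs the logarithm, since [#|A|] is at least 2. The
    first one is at most 1, hence it dominates its own powers, and can be
    compared after raising the estimates to the powers 21 and 19; [2 ^+ 22]
    pays for the passage from [#|A|] to [#|B|], at most a factor of 2. *)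
Definition growth_constant (D : R) : R := (2 ^+ 22 * D)^-1 * ln 2 `^ (1 / 3).

Lemma growth_constant_gt0 D : 1 <= D -> 0 < growth_constant D.
Proof.
move=> D1; rewrite mulr_gt0 ?invr_gt0 ?mulr_gt0 ?exprn_gt0 //; first lra.
by rewrite powR_gt0 // ln_gt0 // ltr1n.
Qed.

Lemma growth_estimate_from_expansion (F : finFieldType) (A : {set F}) (D : R) :
  additive_subgroup A -> (2 <= #|A|)%N -> 1 <= D ->
  let B := inv_set A in let K := expansion R B 1 in
  #|B|%:R <= D * K ^+ 21 \/ #|F|%:R <= D * K ^+ 12 * #|B|%:R ->
  growth_estimate (growth_constant D) A.
Proof.
move=> Asub A2 D1 B K small.
rewrite /growth_estimate diffset_inv_set // -/B.
suff : growth_constant D * growth R A <= #|sumset B B|%:R by [].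
have B0 : B != set0 := inv_set_neq0 Asub A2.
rewrite card_sumset_inv_set // -/K -/B.
set n : R := #|B|%:R in small *; set q : R := #|F|%:R in small.
have n1 : 1 <= n by rewrite ler1n card_gt0.
have K1 : 1 <= K := expansion_ge1 R B0 1.
clearbody K.
have K0 : 0 <= K by lra.
have n0 : 0 <= n by lra.
have D0 : 0 <= D by lra.
pose N : R := #|A|%:R.
have N2 : 2 <= N by rewrite ler_nat.
have Nn : N <= 2 * n by rewrite /N card_inv_set // -addn1 natrD -/B -/n; lra.
have q0 : 0 <= q by rewrite ler0n.
pose c := (2 ^+ 22 * D)^-1.
have D2 : 1 <= 2 ^+ 22 * D by rewrite mulr_ege1 // exprn_ege1 //; lra.
have c0 : 0 <= c by rewrite invr_ge0; lra.
have c1 : c <= 1 by rewrite invf_le1 //; lra.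
have cc k : (0 < k)%N -> c ^+ k <= c.
  by case: k => // k _; rewrite exprS ler_piMr // exprn_ile1.
have cD : c * (2 ^+ 22 * D) = 1 by rewrite mulVf //; lra.
have NX k : N ^+ k <= 2 ^+ k * n ^+ k.
  by rewrite -exprMn lerXn2r // nnegrE; lra.
pose mn := Num.min (N `^ (1 + 1 / 21)) (q `^ (1 / 19) * N `^ (1 - 1 / 19)).
have mn0 : 0 <= mn by rewrite le_min mulr_ge0 ?powR_ge0.
have main : c * mn <= K * n.
  case: small => small.
    apply: le_trans (_ : c * N `^ (1 + 1 / 21) <= _).
      by rewrite ler_wpM2l // ge_min lexx.
    rewrite -(@ler_pXn2r _ 21) ?nnegrE ?mulr_ge0 ?powR_ge0 //.
    rewrite exprMn (@powR_exprn _ _ _ 22); [|lra|by field].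
    apply: le_trans (_ : c * (2 ^+ 22 * n ^+ 22) <= _).
      by rewrite ler_pM ?exprn_ge0 ?cc //; lra.
    apply: le_trans (_ : c * (2 ^+ 22 * (D * K ^+ 21 * n ^+ 21)) <= _).
      rewrite [n ^+ 22]exprS; do 2!rewrite ler_wpM2l ?exprn_ge0 //.
      by rewrite ler_wpM2r // exprn_ge0; lra.
    have -> : c * (2 ^+ 22 * (D * K ^+ 21 * n ^+ 21))
      = c * (2 ^+ 22 * D) * (K ^+ 21 * n ^+ 21) by ring.
    by rewrite cD mul1r exprMn.
  apply: le_trans (_ : c * (q `^ (1 / 19) * N `^ (1 - 1 / 19)) <= _).
    by rewrite ler_wpM2l // ge_min lexx orbT.
  rewrite -(@ler_pXn2r _ 19) ?nnegrE ?mulr_ge0 ?powR_ge0 //.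
  rewrite 2!exprMn (@powR_exprn q _ _ 1); [|lra|by field].
  rewrite (@powR_exprn N _ _ 18); [|lra|by field].
  apply: le_trans (_ : c * (D * K ^+ 12 * n * (2 ^+ 18 * n ^+ 18)) <= _).
    by rewrite ler_pM ?mulr_ge0 ?exprn_ge0 ?cc // ler_pM ?exprn_ge0 ?NX.
  apply: le_trans (_ : c * (2 ^+ 22 * D) * (K ^+ 12 * n ^+ 19) <= _).
    have -> : c * (D * K ^+ 12 * n * (2 ^+ 18 * n ^+ 18)) =
      c * D * (K ^+ 12 * n ^+ 19) * 2 ^+ 18 by ring.
    have -> : c * (2 ^+ 22 * D) * (K ^+ 12 * n ^+ 19) =
      c * D * (K ^+ 12 * n ^+ 19) * 2 ^+ 22 by ring.
    rewrite ler_wpM2l ?mulr_ge0 ?exprn_ge0 // ler_weXn2l //; lra.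
  rewrite cD mul1r exprMn ler_wpM2r ?exprn_ge0 //.
  by rewrite ler_weXn2l.
rewrite /growth -/N -/mn /growth_constant -/c.
have ln2 : 0 < ln 2 :> R by rewrite ln_gt0 // ltr1n.
have lnN : ln 2 <= ln N by rewrite ler_ln // posrE; lra.
have l1 : ln 2 `^ (1 / 3) * ln N `^ (- (1 / 3)) <= 1.
  rewrite powRN ler_pdivrMr ?mul1r ?powR_gt0 //; last exact: lt_le_trans lnN.
  by rewrite ge0_ler_powR // ?nnegrE; lra.
apply: le_trans main.
have -> : c * ln 2 `^ (1 / 3) * (ln N `^ (- (1 / 3)) * mn)
  = c * mn * (ln 2 `^ (1 / 3) * ln N `^ (- (1 / 3))) by ring.
by rewrite ler_piMr // mulr_ge0.
Qed.

End GrowthEstimate.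

Theorem corollary7 (R : realType) :
  (forall K : R, 0 < K ->
     exists2 C : R, 0 < C &
       forall (F : finFieldType) (A : {set F}),
         additive_subgroup A -> (2 <= #|A|)%N ->
         subfield_bound K A -> growth_estimate C A)
  /\
  (exists2 C : R, 0 < C &
     forall (F : finFieldType) (A : {set F}),
       additive_subgroup A -> (2 <= #|A|)%N ->
       avoids_subfield_ranges R A -> growth_estimate C A).
Proof.
have mulpow (D E K n : R) (k l : nat) : 1 <= K -> 0 <= D -> D <= E ->
    (k <= l)%N -> n <= D * K ^+ k -> n <= E * K ^+ l.
  move=> K1 D0 DE kl /le_trans; apply.
  by rewrite ler_pM ?ler_weXn2l // exprn_ge0 //; lra.
have setup (F : finFieldType) (A : {set F}) :
  additive_subgroup A -> (2 <= #|A|)%N ->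
  [/\ 1 <= expansion R (inv_set A) 1, 1 <= #|inv_set A|%:R :> R &
      #|A|%:R <= 2 * #|inv_set A|%:R :> R].
  move=> Asub A2; have B0 := inv_set_neq0 Asub A2.
  have n1 : 1 <= #|inv_set A|%:R :> R by rewrite ler1n card_gt0.
  split=> //; first exact: expansion_ge1.
  by rewrite card_inv_set // -addn1 natrD; lra.
split.
  (* The three terms settle the first case of the dichotomy, and the two values
     of the maximum in the hypothesis when there is a subfield [G]. *)
  move=> K0 K00; pose D : R := 2 ^+ 45 + 2 ^+ 27 * K0 ^+ 2 + 2 ^+ 18 * K0 ^+ 7.
  have t2 : 0 <= 2 ^+ 27 * K0 ^+ 2 by rewrite mulr_ge0 ?exprn_ge0 // ltW.
  have t3 : 0 <= 2 ^+ 18 * K0 ^+ 7 by rewrite mulr_ge0 ?exprn_ge0 // ltW.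
  have t1 : 1 <= 2 ^+ 45 :> R by rewrite exprn_ege1 //; lra.
  have D1 : 1 <= D by rewrite /D; lra.
  exists (growth_constant D); first exact: growth_constant_gt0.
  move=> F A Asub A2 bound; apply: growth_estimate_from_expansion => //; left.
  have [K1 n1 Nn] := setup F A Asub A2.
  have [big|[G [w [Gsub _ Gle nle]]]] := expansion_or_subfield Asub A2 R.
    by apply: mulpow big => //; rewrite /D; lra.
  have := bound G Gsub w 0; set K := expansion R _ 1 in K1 Gle nle *; clearbody K.
  set n : R := #|inv_set A|%:R in n1 Nn Gle nle *.
  set m : R := #|_ :&: _|%:R in nle *; set g : R := #|G|%:R in Gle *.
  set N : R := #|A|%:R in Nn *.
  have g0 : 0 <= g by apply: ler0n.
  have m0 : 0 <= m by apply: ler0n.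
  have N0 : 0 <= N by apply: ler0n.
  have n0 : 0 < n by lra.
  have Kge0 : 0 <= K by lra.
  rewrite maxr_pMr ?le_max; last exact: ltW.
  case/orP => mle.
    have m2 : m ^+ 2 <= K0 ^+ 2 * g.
      have := lerXn2r 2 _ _ mle; rewrite !nnegrE mulr_ge0 ?powR_ge0 ?(ltW K00) //.
      move=> /(_ m0 isT); rewrite exprMn (@powR_exprn _ g _ _ 1) //; last by field.
    (* From [n <= 4 * K * m], [m ^+ 2 <= K0 ^+ 2 * g] and [g <= 2 ^+ 23 * K ^+ 12 * n]. *)
    apply: (mulpow (2 ^+ 27 * K0 ^+ 2) _ _ _ 14%N) => //; first by rewrite /D; lra.
    rewrite -(ler_pM2r n0) -expr2.
    apply: le_trans (_ : (4 * K * m) ^+ 2 <= _); first by rewrite lerXn2r // nnegrE; lra.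
    apply: le_trans (_ : 16 * K ^+ 2 * (K0 ^+ 2 * (2 ^+ 23 * K ^+ 12 * n)) <= _).
      have -> : (4 * K * m) ^+ 2 = 16 * K ^+ 2 * m ^+ 2 by ring.
      rewrite ler_wpM2l ?mulr_ge0 //; apply: le_trans m2 _.
      by rewrite ler_wpM2l // exprn_ge0 // ltW.
    by apply: le_of_eq; ring.
  have m7 : m ^+ 7 <= K0 ^+ 7 * N ^+ 4.
    have := lerXn2r 7 _ _ mle; rewrite !nnegrE mulr_ge0 ?powR_ge0 ?(ltW K00) //.
    move=> /(_ m0 isT); rewrite exprMn (@powR_exprn _ N _ _ 4) //; last by field.
  (* From [n <= 4 * K * m] and [m ^+ 7 <= K0 ^+ 7 * N ^+ 4]. *)
  apply: (mulpow (2 ^+ 18 * K0 ^+ 7) _ _ _ 7%N) => //; first by rewrite /D; lra.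
  apply: le_trans (_ : n ^+ 3 <= _); first by rewrite ler_eXnr.
  rewrite -(ler_pM2r (exprn_gt0 4 n0)) -exprD.
  apply: le_trans (_ : (4 * K * m) ^+ 7 <= _); first by rewrite lerXn2r // nnegrE; lra.
  apply: le_trans (_ : (4 * K) ^+ 7 * (K0 ^+ 7 * (2 * n) ^+ 4) <= _).
    rewrite exprMn ler_wpM2l ?exprn_ge0 //; first lra.
    apply: le_trans m7 _; rewrite ler_wpM2l ?exprn_ge0 ?(ltW K00) //.
    by rewrite lerXn2r // nnegrE; lra.
  by apply: le_of_eq; ring.
have D1 : 1 <= 2 ^+ 45 :> R by rewrite exprn_ege1 //; lra.
exists (growth_constant (2 ^+ 45)); first exact: growth_constant_gt0.
move=> F A Asub A2 avoid; apply: growth_estimate_from_expansion => //.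
have [K1 n1 Nn] := setup F A Asub A2.
have [big|[G [w [Gsub nG Gle _]]]] := expansion_or_subfield Asub A2 R; first by left.
set K := expansion R _ 1 in K1 nG Gle *; clearbody K.
set n : R := #|inv_set A|%:R in n1 Nn nG Gle *.
have n0 : 0 < n by lra.
have two k l : (k <= l)%N -> 2 ^+ k <= 2 ^+ l :> R.
  by move=> kl; rewrite ler_weXn2l // ler1n.
have Kge0 : 0 <= K by lra.
case: (eqVneq G [set: F]) => [GF|GF].
  right; move: Gle; rewrite GF cardsT => /le_trans; apply.
  by rewrite !ler_wpM2r ?exprn_ge0 ?two // ltW.
left; have := avoid G; rewrite /proper_subfield properT => /(_ (conj Gsub GF)).
set g : R := #|G|%:R in nG Gle *; set N : R := #|A|%:R in Nn *.
have g0 : 0 <= g by apply: ler0n.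
have N0 : 0 <= N by apply: ler0n.
have nN : n <= N by rewrite ler_nat (card_inv_set Asub).
move=> /negP; rewrite negb_and -!leNgt => /orP [Ng|gN].
  (* Here [n ^+ 2 <= N ^+ 2 <= g], while [g <= 2 ^+ 23 * K ^+ 12 * n]. *)
  apply: (mulpow (2 ^+ 23) _ _ _ 12%N) => //; rewrite ?two ?exprn_ge0 //.
  rewrite -(ler_pM2r n0) -expr2; apply: le_trans Gle.
  apply: le_trans (_ : (g `^ (1 / 2)) ^+ 2 <= _).
    by rewrite lerXn2r ?nnegrE ?powR_ge0 //; lra.
  by rewrite (@powR_exprn _ g _ _ 1) //; field.
(* Here [g ^+ 10 <= N ^+ 7], while [n <= 4 * K * g]. *)
apply: (mulpow (2 ^+ 27) _ _ _ 10%N) => //; rewrite ?two ?exprn_ge0 //.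
apply: le_trans (_ : n ^+ 3 <= _); first by rewrite ler_eXnr.
rewrite -(ler_pM2r (exprn_gt0 7 n0)) -exprD.
apply: le_trans (_ : (4 * K * g) ^+ 10 <= _); first by rewrite lerXn2r // nnegrE; lra.
apply: le_trans (_ : (4 * K) ^+ 10 * (2 * n) ^+ 7 <= _).
  rewrite exprMn ler_wpM2l ?exprn_ge0 //; first lra.
  apply: le_trans (_ : N ^+ 7 <= _); last by rewrite lerXn2r // nnegrE; lra.
  rewrite -(@powR_exprn _ g (1 + 3 / 7) 7) //; last by field.
  by rewrite lerXn2r ?nnegrE ?powR_ge0.
by apply: le_of_eq; ring.
Qed.
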